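(* Let $R,C\ge1$ and $N\ge 3$ be integers and let $1=r_1<r_2<\cdots<r_{N+1}=R+1$ and $1=c_1<c_2<\cdots<c_{N+1}=C+1$ be integers. Let $$S=\{(i,j)\mid r_n\le i<r_{n+1},\ c_n\le j<c_{n+1}\text{ for some }1\le n\le N\}.$$ Then the set of moves of Types I, II, III and IV in $\mathcal{M}_S$ forms a Markov basis for the configuration $A_S$.
   Context: Let $\mathbb{N}=\{0,1,2,\ldots\}$ and $\mathcal{I}=\{(i,j)\mid 1\le i\le R,\ 1\le j\le C\}$. The configuration $A_S$ is the zero-one matrix with $A_S\mathbf{x}=(x_{1+},\ldots,x_{R+},x_{+1},\ldots,x_{+C},x_S)'$ for $\mathbf{x}=(x_{ij})_{(i,j)\in\mathcal{I}}$, where $x_{i+}=\sum_jx_{ij}$, $x_{+j}=\sum_ix_{ij}$, $x_S=\sum_{(i,j)\in S}x_{ij}$. The set of moves is $\mathcal{M}_S=\{\mathbf{z}\in\mathbb{Z}^{\mathcal{I}}\mid A_S\mathbf{z}=0\}$, and the fibers are $\mathcal{F}_{\mathbf{t}}=\{\mathbf{x}\in\mathbb{N}^{\mathcal{I}}\mid A_S\mathbf{x}=\mathbf{t}\}$. A finite set $\mathcal{B}\subseteq\mathcal{M}_S$ that is sign-invariant ($\mathbf{z}\in\mathcal{B}\Rightarrow-\mathbf{z}\in\mathcal{B}$) is a Markov basis for $A_S$ if for every $\mathbf{t}$ and all $\mathbf{x}\ne\mathbf{y}$ in $\mathcal{F}_{\mathbf{t}}$ there exist $U>0$ and $\mathbf{z}_1,\ldots,\mathbf{z}_U\in\mathcal{B}$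 (repetitions allowed) with $\mathbf{y}=\mathbf{x}+\sum_{s=1}^{U}\mathbf{z}_s$ and $\mathbf{x}+\sum_{s=1}^{u}\mathbf{z}_s\in\mathcal{F}_{\mathbf{t}}$ for $1\le u\le U$. Blocks: $\mathcal{I}_{kl}=\{(i,j)\mid r_k\le i<r_{k+1},\ c_l\le j<c_{l+1}\}$ for $1\le k,l\le N$, so $S=\mathcal{I}_{11}\cup\cdots\cup\mathcal{I}_{NN}$; $S^C=\mathcal{I}\setminus S$. Two rows $i,i'$ belong to the same block of rows if $r_k\le i,i'<r_{k+1}$ for some $k$; similarly for columns. Let $E_{ij}$ denote the table with entry $1$ at $(i,j)$ and $0$ elsewhere. Type I: $E_{i_1j_1}+E_{i_2j_2}-E_{i_1j_2}-E_{i_2j_1}$ with $i_1\ne i_2$, $j_1\ne j_2$. Type II: $E_{i_1j_2}+E_{i_2j_3}+E_{i_3j_1}-E_{i_1j_3}-E_{i_2j_1}-E_{i_3j_2}$ with $i_1,i_2,i_3$ distinct and $j_1,j_2,j_3$ distinct, where the six nonzero cells belong to distinct blocks in $S^C$. Type III: $E_{i_1j_1}+E_{i_2j_3}+E_{i_3j_2}-E_{i_1j_3}-E_{i_2j_2}-E_{i_3j_1}$ with $i_1,i_2,i_3$ distinct and $j_1,j_2,j_3$ distinct, where $(i_1,j_1)$ and $(i_2,j_2)$ belong to distinct blocks in $S$ and the other four nonzero cells belong to distinct blocks in $S^C$. Type IV: $E_{i_1j_1}+E_{i_2j_2}+E_{i_3j_3}+E_{i_4j_4}-E_{i_1j_3}-E_{i_2j_4}-E_{i_3j_2}-E_{i_4j_1}$,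 where $(i_1,j_1)$ and $(i_3,j_2)$ belong to distinct blocks in $S$, the other six listed cells belong to (not necessarily distinct) blocks in $S^C$, rows $i_1,i_2$ belong to the same block of rows, and rows $i_3,i_4$ belong to the same block of rows; the indices need not be distinct ($i_1=i_2$, $i_3=i_4$, $j_3=j_4$ are allowed), so these moves of degree 4 may be square-free or not. Type IV also includes the transposes of these moves: $E_{i_1j_1}+E_{i_2j_2}+E_{i_3j_3}+E_{i_4j_4}-E_{i_3j_1}-E_{i_4j_2}-E_{i_2j_3}-E_{i_1j_4}$, where $(i_1,j_1)$ and $(i_2,j_3)$ belong to distinct blocks in $S$, the other six listed cells belong to blocks in $S^C$, columns $j_1,j_2$ belong to the same block of columns, and columns $j_3,j_4$ belong to the same block of columns (indices not necessarily distinct). *)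

(* Defs.v *)
From HB Require Import structures.
From mathcomp Require Import all_boot all_order all_algebra.
From mathcomp Require Import classical_sets cardinality.

Set Implicit Arguments.
Unset Strict Implicit.
Unset Printing Implicit Defensive.

Import Order.TTheory GRing.Theory Num.Theory.
Local Open Scope ring_scope.

(* Rows and columns are numbered from 0, as are the breakpoints: a partition  *)
(* 1 = r_1 < ... < r_{N+1} = R + 1 of the rows 1, ..., R is encoded by        *)
(* r : nat -> nat with r 0 = 0 < ... < r N = R, the k-th part (k < N) being   *)
(* {i | r k <= i < r (k + 1)}.  Only the values r 0, ..., r N matter.         *)

Definition partition_points (N R : nat) (r : nat -> nat) : Prop :=
  [/\ r 0 = 0, r N = R & forall k, (k < N)%N -> (r k < r k.+1)%N]%N.

Definition same_part (N R : nat) (r : nat -> nat) (i i' : 'I_R) : bool :=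
  [exists k : 'I_N, (r k <= i < r k.+1)%N && (r k <= i' < r k.+1)%N].

Definition block (R C : nat) (r c : nat -> nat) (k l : nat) :
    {set 'I_R * 'I_C} :=
  [set p : 'I_R * 'I_C | (r k <= p.1 < r k.+1)%N && (c l <= p.2 < c l.+1)%N]%SET.

Definition diagonal_blocks (R C N : nat) (r c : nat -> nat) :
    {set 'I_R * 'I_C} :=
  (\bigcup_(n < N) block R C r c n n)%SET.

Definition same_block (R C N : nat) (r c : nat -> nat) (p q : 'I_R * 'I_C) :
    bool :=
  [exists k : 'I_N, exists l : 'I_N,
    (p \in block R C r c k l) && (q \in block R C r c k l)].

Definition in_distinct_blocks (R C N : nat) (r c : nat -> nat)
    (D : {set 'I_R * 'I_C}) (cells : seq ('I_R * 'I_C)) : bool :=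
  all (mem D) cells && pairwise (fun p q => ~~ same_block N r c p q) cells.

(* A table x is identified with the column vector (mxvec x)^T; each row of    *)
(* the configuration is the vectorized indicator table of a row, of a column, *)
(* or of S.                                                                   *)
Definition config (R C : nat) (S : {set 'I_R * 'I_C}) :
    'M[int]_(R + C + 1, R * C) :=
  col_mx
    (col_mx (\matrix_(i < R) mxvec (\matrix_(a < R, b < C) (a == i)%:R))
            (\matrix_(j < C) mxvec (\matrix_(a < R, b < C) (b == j)%:R)))
    (mxvec (\matrix_(a < R, b < C) ((a, b) \in S)%:R)).

Definition statistic (R C : nat) (S : {set 'I_R * 'I_C}) (x : 'M[int]_(R, C)) :
    'cV[int]_(R + C + 1) :=
  config S *m (mxvec x)^T.

Lemma statisticE (R C : nat) (S : {set 'I_R * 'I_C}) (x : 'M[int]_(R, C)) :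
  statistic S x =
  col_mx (col_mx (\col_(i < R) \sum_(j < C) x i j)
                 (\col_(j < C) \sum_(i < R) x i j))
         (const_mx (\sum_(p in S) x p.1 p.2)).
Proof.
have dot (f : 'I_R -> 'I_C -> int) :
    \sum_k mxvec (\matrix_(a, b) f a b) 0 k * mxvec x 0 k =
    \sum_a \sum_b f a b * x a b.
  rewrite pair_bigA /= (reindex _ (curry_mxvec_bij _ _)) /=.
  by apply: eq_bigr => -[a b] _; rewrite !mxvecE mxE.
rewrite /statistic /config !mul_col_mx; congr (col_mx (col_mx _ _) _).
- apply/matrixP => i k; rewrite !mxE ord1.
  under eq_bigr do rewrite 2!mxE.
  rewrite dot (bigD1 i) //= [X in _ + X]big1 ?addr0.
    by apply: eq_bigr => b _; rewrite eqxx mul1r.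
  by move=> a /negPf ai; rewrite big1 // => b _; rewrite ai mul0r.
- apply/matrixP => j k; rewrite !mxE ord1.
  under eq_bigr do rewrite 2!mxE.
  rewrite dot; apply: eq_bigr => a _.
  rewrite (bigD1 j) //= eqxx mul1r big1 ?addr0 // => b /negPf bj.
  by rewrite bj mul0r.
apply/matrixP => i k; rewrite !mxE !ord1.
under eq_bigr do rewrite [X in _ * X]mxE.
rewrite dot pair_bigA /= [RHS]big_mkcond /=.
by apply: eq_bigr => -[a b] _ /=; case: ifP => _; rewrite ?mul1r ?mul0r.
Qed.

Definition moves (R C : nat) (S : {set 'I_R * 'I_C}) : set 'M[int]_(R, C) :=
  [set z : 'M[int]_(R, C) | statistic S z = 0]%classic.

Definition fiber (R C : nat) (S : {set 'I_R * 'I_C})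
    (t : 'cV[int]_(R + C + 1)) : set 'M[int]_(R, C) :=
  [set x : 'M[int]_(R, C) |
    (forall i j, 0 <= x i j) /\ statistic S x = t]%classic.

Definition markov_basis (R C : nat) (S : {set 'I_R * 'I_C})
    (B : set 'M[int]_(R, C)) : Prop :=
  [/\ finite_set B,
      (B `<=` moves S)%classic,
      forall z, B z -> B (- z) &
      forall (t : 'cV[int]_(R + C + 1)) (x y : 'M[int]_(R, C)),
        fiber S t x -> fiber S t y -> x <> y ->
        exists (U : nat) (z : nat -> 'M[int]_(R, C)),
          [/\ (0 < U)%N,
              forall s, (s < U)%N -> B (z s),
              y = x + \sum_(s < U) z s &
              forall u, (1 <= u <= U)%N -> fiber S t (x + \sum_(s < u) z s)]].

Definition E (R C : nat) (i : 'I_R) (j : 'I_C) : 'M[int]_(R, C) :=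
  delta_mx i j.

Definition type_I (R C : nat) : set 'M[int]_(R, C) :=
  [set z : 'M[int]_(R, C) | exists (i1 i2 : 'I_R) (j1 j2 : 'I_C),
    [/\ i1 != i2, j1 != j2 &
        z = E i1 j1 + E i2 j2 - E i1 j2 - E i2 j1]]%classic.

Definition type_II (R C N : nat) (r c : nat -> nat) : set 'M[int]_(R, C) :=
  [set z : 'M[int]_(R, C) | exists (i1 i2 i3 : 'I_R) (j1 j2 j3 : 'I_C),
    [/\ uniq [:: i1; i2; i3], uniq [:: j1; j2; j3],
        in_distinct_blocks N r c (~: diagonal_blocks R C N r c)%SET
          [:: (i1, j2); (i2, j3); (i3, j1); (i1, j3); (i2, j1); (i3, j2)] &
        z = E i1 j2 + E i2 j3 + E i3 j1
            - E i1 j3 - E i2 j1 - E i3 j2]]%classic.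

Definition type_III (R C N : nat) (r c : nat -> nat) : set 'M[int]_(R, C) :=
  [set z : 'M[int]_(R, C) | exists (i1 i2 i3 : 'I_R) (j1 j2 j3 : 'I_C),
    [/\ uniq [:: i1; i2; i3], uniq [:: j1; j2; j3],
        in_distinct_blocks N r c (diagonal_blocks R C N r c)
          [:: (i1, j1); (i2, j2)],
        in_distinct_blocks N r c (~: diagonal_blocks R C N r c)%SET
          [:: (i2, j3); (i3, j2); (i1, j3); (i3, j1)] &
        z = E i1 j1 + E i2 j3 + E i3 j2
            - E i1 j3 - E i2 j2 - E i3 j1]]%classic.

(* The indices are deliberately not required to be distinct: i1 = i2, i3 = i4 *)
(* and j3 = j4 (j1 = j2, j3 = j4 and i3 = i4 for the transposed moves) are    *)
(* allowed.                                                                   *)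
Definition type_IV_rows (R C N : nat) (r c : nat -> nat) :
    set 'M[int]_(R, C) :=
  [set z : 'M[int]_(R, C) | exists (i1 i2 i3 i4 : 'I_R) (j1 j2 j3 j4 : 'I_C),
    [/\ in_distinct_blocks N r c (diagonal_blocks R C N r c)
          [:: (i1, j1); (i3, j2)],
        all (mem (~: diagonal_blocks R C N r c)%SET)
          [:: (i2, j2); (i3, j3); (i4, j4); (i1, j3); (i2, j4); (i4, j1)],
        same_part N r i1 i2, same_part N r i3 i4 &
        z = E i1 j1 + E i2 j2 + E i3 j3 + E i4 j4
            - E i1 j3 - E i2 j4 - E i3 j2 - E i4 j1]]%classic.

Definition type_IV_cols (R C N : nat) (r c : nat -> nat) :
    set 'M[int]_(R, C) :=
  [set z : 'M[int]_(R, C) | exists (i1 i2 i3 i4 : 'I_R) (j1 j2 j3 j4 : 'I_C),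
    [/\ in_distinct_blocks N r c (diagonal_blocks R C N r c)
          [:: (i1, j1); (i2, j3)],
        all (mem (~: diagonal_blocks R C N r c)%SET)
          [:: (i2, j2); (i3, j3); (i4, j4); (i3, j1); (i4, j2); (i1, j4)],
        same_part N c j1 j2, same_part N c j3 j4 &
        z = E i1 j1 + E i2 j2 + E i3 j3 + E i4 j4
            - E i3 j1 - E i4 j2 - E i2 j3 - E i1 j4]]%classic.

Arguments type_I : clear implicits.
Arguments type_II : clear implicits.
Arguments type_III : clear implicits.
Arguments type_IV_rows : clear implicits.
Arguments type_IV_cols : clear implicits.

Definition type_IV (R C N : nat) (r c : nat -> nat) : set 'M[int]_(R, C) :=
  (type_IV_rows R C N r c `|` type_IV_cols R C N r c)%classic.
Arguments type_IV : clear implicits.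

(* Main.v *)
(* View a table as a multiset of cells (i, j), and send each cell to its block
   (k, l), so that S consists of the loops k = l.  Given two tables x, y of
   the same fiber, one brings them together by moves applied to x or to y
   that reduce, in turn, four distances.
   - Loop counts.  If x has more loops at k and fewer loops at l than y, then
     a loop is moved from k to l in x, or from l to k in y.  Type III does
     this in x if x has cells in the blocks (l, p) and (q, l) with p, q not in
     {k, l}.  If such cells are missing in both x and y, comparing the totals
     of the rows and columns k and l leaves exactly two possibilities, where
     Type IV or its transpose applies to x.
   - Block counts, the loop counts being equal.  The difference vanishes on
     the loops.  If a basic swap is not available, the signs of the difference
     contain an alternating hexagon on three rows and the three columns of the
     same indices, and Type II cancels it.
   - Counts by block of rows and column, then entries: swaps within a block of
     columns, respectively of rows, do not affect S. *)

Require Import Defs.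
From mathcomp Require Import all_boot all_order all_algebra.
From mathcomp Require Import classical_sets cardinality.
From mathcomp Require Import zify ring.

Import Order.TTheory GRing.Theory Num.Theory.
Local Open Scope ring_scope.

Set Implicit Arguments.
Unset Strict Implicit.
Unset Printing Implicit Defensive.

Ltac table_ring := apply/matrixP => ? ?; rewrite !mxE; ring.

(** * Totals over sets of cells, and norms of aggregated differences *)

Section Aggregation.
Variables R C : nat.
Implicit Types (x y w : 'M[int]_(R, C)) (P : pred ('I_R * 'I_C)).

Definition nonneg x : Prop := forall i j, 0 <= x i j.

Definition tot P x : int := \sum_(p | P p) x p.1 p.2.

Lemma totD P x y : tot P (x + y) = tot P x + tot P y.
Proof. by rewrite -big_split; apply: eq_bigr => p _; rewrite mxE. Qed.

Lemma totN P x : tot P (- x) = - tot P x.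
Proof. by rewrite -sumrN; apply: eq_bigr => p _; rewrite mxE. Qed.

Lemma totE P i j : tot P (E i j) = (P (i, j))%:Z.
Proof.
rewrite /tot big_mkcond (bigD1 (i, j)) //= big1 => [|p pij].
  by rewrite mxE !eqxx addr0; case: (P _).
by rewrite mxE -xpair_eqE -surjective_pairing (negPf pij); case: (P p).
Qed.

Lemma tot_ge0 P x : nonneg x -> 0 <= tot P x.
Proof. by move=> x0; apply: sumr_ge0. Qed.

Lemma eq_tot P P' x : P =1 P' -> tot P x = tot P' x.
Proof. exact: eq_bigl. Qed.

Lemma tot_split P P' x :
  tot P x = tot (fun p => P p && P' p) x + tot (fun p => P p && ~~ P' p) x.
Proof. exact: bigID. Qed.

(** A positive integer entry is at least 1, so it can lose one unit. The cells that a move removes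
    are picked in this way, one after the other. *)
Lemma pick_cell P x : nonneg x -> 0 < tot P x ->
  exists i j, P (i, j) /\ nonneg (x - E i j).
Proof.
move=> x0 Px.
have [[i j] /andP[Pij xij] | none] := pickP [pred p | P p & 0 < x p.1 p.2].
  exists i, j; split=> // a b; rewrite !mxE.
  by have := x0 a b; move: xij => /=;
    case: eqP => [->|]; case: eqP => [->|] /=; lia.
move: Px; rewrite /tot big1 // => p Pp.
have /= := none p; rewrite Pp /= => /negbT; rewrite -leNgt => xp.
by apply/eqP; rewrite eq_le xp x0.
Qed.

Lemma nonneg_addE x i j : nonneg x -> nonneg (x + E i j).
Proof. by move=> x0 a b; rewrite !mxE addr_ge0. Qed.

Section Key.
Variables (T : finType) (h : 'I_R * 'I_C -> T).

Definition agg x (t : T) : int := tot (fun p => h p == t) x.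

Lemma aggE i j t : agg (E i j) t = (h (i, j) == t)%:Z.
Proof. exact: totE. Qed.

Lemma aggD x y t : agg (x + y) t = agg x t + agg y t.
Proof. exact: totD. Qed.

Lemma aggN x t : agg (- x) t = - agg x t.
Proof. exact: totN. Qed.

Definition norm x : int := \sum_t `|agg x t|.

Lemma norm_ge0 x : 0 <= norm x.
Proof. exact: sumr_ge0. Qed.

Lemma normN x : norm (- x) = norm x.
Proof. by apply: eq_bigr => t _; rewrite aggN normrN. Qed.

(** A single cell affects a single class. With [normB1], this lets the norm be followed cell by cell
    along a move. *)
Lemma normD1 x i j (e := h (i, j)) :
  norm (x + E i j) = norm x - `|agg x e| + `|agg x e + 1|.
Proof.
rewrite /norm (bigD1 e) //= [in RHS](bigD1 e) //= aggD aggE eqxx.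
rewrite (eq_bigr (fun t => `|agg x t|)).
  by move: (\sum_(i | _) _) => s /=; lia.
by move=> t te; rewrite aggD aggE eq_sym (negPf te) addr0.
Qed.

Lemma normB1 x i j (e := h (i, j)) :
  norm (x - E i j) = norm x - `|agg x e| + `|agg x e - 1|.
Proof.
rewrite -normN opprB addrC normD1 normN !aggN -/e.
lia.
Qed.

Lemma norm_neq0 x : norm x <> 0 -> exists t, agg x t != 0.
Proof.
move=> nx; have [/existsP // | /existsPn a0] := boolP [exists t, agg x t != 0].
by case: nx; apply: big1 => t _; have /negPn/eqP -> := a0 t.
Qed.

Lemma norm_eq0 x : norm x = 0 -> forall t, agg x t = 0.
Proof.
move=> /eqP; rewrite psumr_eq0 // => /allP x0 t.
by apply/normr0_eq0/eqP; apply: x0; rewrite mem_index_enum.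
Qed.

Lemma tot_agg (Q : pred T) x :
  tot (fun p => Q (h p)) x = \sum_(t | Q t) agg x t.
Proof.
rewrite /tot (partition_big h Q) //=; apply: eq_bigr => t Qt.
by apply: eq_bigl => p; case: eqP => [->|]; rewrite ?Qt ?andbF.
Qed.

(** If no term were negative, the sum would be at least its positive term. Applied along a row, a
    column or a block, this supplies the corners of the swaps. *)
Lemma agg_neg (Q : pred T) x t : tot (fun p => Q (h p)) x = 0 -> Q t ->
  0 < agg x t -> exists2 t', Q t' & agg x t' < 0.
Proof.
rewrite tot_agg => s0 Qt xt.
have [t' /andP[Qt' xt'] | none] := pickP [pred t' | Q t' & agg x t' < 0].
  by exists t'.
have : 0 <= \sum_(i | Q i && (i != t)) agg x i.
  by apply: sumr_ge0 => u /andP[Qu _]; have /= := none u; rewrite Qu; lia.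
by move: s0; rewrite (bigD1 t) //=; move: (\sum_(i | _) _) => s; lia.
Qed.

End Key.

(** * Basic swaps that bring two tables closer *)

Section Swap.
Variables (A B : finType) (u : 'I_R -> A) (v : 'I_C -> B).

Definition prod_key (p : 'I_R * 'I_C) : A * B := (u p.1, v p.2).

(* x - y can only be negative where y is positive, so the two cells to be
   removed are present in y; the fourth corner (a', b') costs at most 1. *)
Lemma closer_swap x y a a' b b' : nonneg x -> nonneg y ->
  0 < agg prod_key (x - y) (a, b) -> agg prod_key (x - y) (a, b') < 0 ->
  agg prod_key (x - y) (a', b) < 0 ->
  exists i i' j j', [/\ (i != i') && (j != j'), u i = a /\ u i' = a',
    v j = b /\ v j' = b' &
    let z := E i j + E i' j' - E i j' - E i' j in
    nonneg (y + z) /\ norm prod_key (x - (y + z)) < norm prod_key (x - y)].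
Proof.
have keyE i j : prod_key (i, j) = (u i, v j) by [].
move=> x0 y0 wab wab' wa'b.
have aa' : a != a' by apply: contraTneq wab => ->; rewrite -leNgt ltW.
have bb' : b != b' by apply: contraTneq wab => ->; rewrite -leNgt ltW.
have yge t : agg prod_key (x - y) t < 0 -> 0 < agg prod_key y t.
  rewrite aggD aggN.
  by have := tot_ge0 (fun p => prod_key p == t) x0; rewrite -/(agg _ x t); lia.
have [i [j' [/eqP[ui vj'] y1]]] := pick_cell y0 (yge _ wab').
(* The two negative corners are in different classes because [a != a'], so removing the first cell
   leaves the count at the second intact. *)
have yb : 0 < agg prod_key (y - E i j') (a', b).
  rewrite aggD aggN aggE keyE ui vj' xpair_eqE (negPf aa') subr0; exact: yge.
have [i' [j [/eqP[ui' vj] y2]]] := pick_cell y1 yb.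
exists i, i', j, j'; split=> //=.
  apply/andP; split; [apply: contraNneq aa' | apply: contraNneq bb'] => e.
    by rewrite -ui -ui' e.
  by rewrite -vj -vj' e.
split.
  have -> : y + (E i j + E i' j' - E i j' - E i' j) =
            y - E i j' - E i' j + E i j + E i' j' by table_ring.
  by do 2!apply: nonneg_addE.
have -> : x - (y + (E i j + E i' j' - E i j' - E i' j)) =
          x - y - E i j + E i j' + E i' j - E i' j' by table_ring.
move: (x - y) wab wab' wa'b => w wab wab' wa'b.
rewrite normB1 !normD1 normB1 !(aggD, aggN, aggE) !keyE ui ui' vj vj'.
rewrite !xpair_eqE !eqxx (negPf aa') (negPf bb') /=.
lia.
Qed.

End Swap.
End Aggregation.

(** * Connection of tables by moves, and descent on a norm *)

Section Moves.
Variables (R C : nat) (S : {set 'I_R * 'I_C}).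
Implicit Types x y z : 'M[int]_(R, C).

Lemma statistic_eq0P z : statistic S z = 0 <->
  [/\ forall i, tot (fun p => p.1 == i) z = 0,
      forall j, tot (fun p => p.2 == j) z = 0 & tot (mem S) z = 0].
Proof.
have rowE i : tot (fun p => p.1 == i) z = \sum_j z i j.
  rewrite /tot (eq_bigl (fun p => (p.1 == i) && xpredT p.2)) => [|p].
    by rewrite -(pair_big (pred1 i) xpredT (fun i j => z i j)) big_pred1_eq.
  by rewrite andbT.
have colE j : tot (fun p => p.2 == j) z = \sum_i z i j.
  rewrite /tot (eq_bigl (fun p => xpredT p.1 && (p.2 == j))) //.
  rewrite -(pair_big xpredT (pred1 j) (fun i j => z i j)) /=.
  by apply: eq_bigr => i _; rewrite big_pred1_eq.
rewrite statisticE -[X in _ = X]vsubmxK -[usubmx 0]vsubmxK !linear0; split.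
  move=> /eq_col_mx[/eq_col_mx[rz cz] sz]; split=> [i|j|].
  - by rewrite rowE; move/matrixP: rz => /(_ i 0); rewrite !mxE.
  - by rewrite colE; move/matrixP: cz => /(_ j 0); rewrite !mxE.
  - by move/matrixP: sz => /(_ 0 0); rewrite !mxE.
move=> [rz cz sz]; congr (col_mx (col_mx _ _) _); apply/matrixP => i k.
- by rewrite !mxE -rowE.
- by rewrite !mxE -colE.
- by rewrite !mxE -[RHS]sz.
Qed.

Lemma statisticD x y : statistic S (x + y) = statistic S x + statistic S y.
Proof. by rewrite /statistic !linearD. Qed.

Lemma statisticN x : statistic S (- x) = - statistic S x.
Proof. by rewrite /statistic !linearN. Qed.

(** Only nonnegativity is imposed along a path, on the tables reached after the start; the statistic
    is constant as soon as [B] consists of moves. *)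
Inductive connected (B : set 'M[int]_(R, C)) x : 'M[int]_(R, C) -> Prop :=
| connected_refl : connected B x x
| connected_step y z :
    connected B x y -> B z -> nonneg (y + z) -> connected B x (y + z).

Section Connected.
Variable B : set 'M[int]_(R, C).
Hypothesis sub_B : (B `<=` moves S)%classic.
Hypothesis oppB : forall z, B z -> B (- z).

Lemma connected1 x z : B z -> nonneg (x + z) -> connected B x (x + z).
Proof. exact/connected_step/connected_refl. Qed.

Lemma connected_trans x y z :
  connected B x y -> connected B y z -> connected B x z.
Proof. by move=> xy; elim=> // t m _ xt Bm tm0; apply: connected_step. Qed.

Lemma connected_nonneg x y : connected B x y -> nonneg x -> nonneg y.
Proof. by case. Qed.

Lemma connected_statistic x y :
  connected B x y -> statistic S y = statistic S x.
Proof.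
elim=> // t m _ IH /sub_B Bm _.
by rewrite statisticD IH (_ : statistic S m = 0) ?addr0.
Qed.

Lemma connected_sym x y : nonneg x -> connected B x y -> connected B y x.
Proof.
move=> x0; elim=> [|t m xt IH Bm tm0]; first exact: connected_refl.
apply: connected_trans IH.
have {2}-> : t = t + m - m by rewrite addrK.
apply: connected1; first exact: oppB.
by rewrite addrK; apply: connected_nonneg xt x0.
Qed.

Lemma connected_path x y : connected B x y ->
  exists (U : nat) (z : nat -> 'M[int]_(R, C)),
    [/\ forall s, (s < U)%N -> B (z s), y = x + \sum_(s < U) z s &
        forall u, (1 <= u <= U)%N ->
          nonneg (x + \sum_(s < u) z s) /\
          statistic S (x + \sum_(s < u) z s) = statistic S x].
Proof.
(* Connectedness stays as a premise of the induction, so that the statistic of the new endpoint is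
   known when a step is appended. *)
move=> xy; have: connected B x y by [].
elim: xy => [|t m xt [//|U [z [Bz tE zP]]] Bm tm0 xtm].
  by exists 0%N, (fun=> 0); split=> [|| [] //]; rewrite ?big_ord0 ?addr0.
pose z' s := if s == U then m else z s.
have sumE u : (u <= U)%N -> \sum_(s < u) z' s = \sum_(s < u) z s.
  move=> uU; apply: eq_bigr => s _; rewrite /z' ifN // neq_ltn.
  by rewrite (leq_trans (ltn_ord s) uU).
have sumU : t + m = x + \sum_(s < U.+1) z' s.
  by rewrite big_ord_recr /= sumE // addrA -tE /z' eqxx.
exists U.+1, z'; split=> // [s|u].
  by rewrite ltnS leq_eqVlt /z'; case: eqP => //= _; apply: Bz.
case/andP=> u1; rewrite leq_eqVlt => /predU1P[->|uU].
  by rewrite -sumU; split=> //; apply: connected_statistic.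
by rewrite sumE //; apply: zP; rewrite u1.
Qed.

(* Q records the distances already brought to 0. *)
Lemma descent (T : finType) (h : 'I_R * 'I_C -> T)
    (Q : 'M[int]_(R, C) -> Prop) :
    (forall x y, nonneg x -> nonneg y -> statistic S (x - y) = 0 -> Q (x - y) ->
       norm h (x - y) <> 0 ->
       exists x' y', [/\ connected B x x', connected B y y', Q (x' - y') &
                         norm h (x' - y') < norm h (x - y)]) ->
    (forall x y, nonneg x -> nonneg y -> statistic S (x - y) = 0 ->
       (forall t, agg h (x - y) t = 0) -> connected B x y) ->
  forall x y, nonneg x -> nonneg y -> statistic S (x - y) = 0 -> Q (x - y) ->
    connected B x y.
Proof.
move=> dec base x y.
have [n le_n] : exists n : nat, norm h (x - y) < n%:Z.
  by exists `|norm h (x - y)|.+1%N; have := norm_ge0 h (x - y); lia.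
elim: n => [|n IH] in x y le_n *; first by have := norm_ge0 h (x - y); lia.
move=> x0 y0 sxy Qxy; have [/norm_eq0 | /eqP nxy] := eqVneq (norm h (x - y)) 0.
  exact: base.
have [x' [y' [xx' yy' Q' lt_norm]]] := dec x y x0 y0 sxy Qxy nxy.
(* The path goes from [x] to [x'], then to [y'] by induction, then to [y] by undoing the moves
   applied to [y]. *)
apply: (connected_trans xx'); apply: connected_trans (connected_sym y0 yy').
apply: IH => //; first by lia.
- exact: connected_nonneg xx' x0.
- exact: connected_nonneg yy' y0.
rewrite statisticD statisticN (connected_statistic xx').
rewrite (connected_statistic yy').
by rewrite -statisticN -statisticD.
Qed.

End Connected.
End Moves.

(** * Block indices, and the moves of each type *)

Section BlockModel.
Variables (R C N : nat) (r c : nat -> nat).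
(** [f] and [g] give the index of the part of a row or a column, which turns every condition on
    breakpoints into equalities of indices. They are constructed in [part_indexP]. *)
Variables (f : 'I_R -> 'I_N) (g : 'I_C -> 'I_N).
Hypothesis rowP :
  forall (i : 'I_R) (k : 'I_N), (r k <= i < r k.+1)%N = (f i == k).
Hypothesis colP :
  forall (j : 'I_C) (l : 'I_N), (c l <= j < c l.+1)%N = (g j == l).
Implicit Types (x y z w : 'M[int]_(R, C)) (k l : 'I_N).

Local Notation S := (diagonal_blocks R C N r c).
Local Notation basis := (moves S `&`
     (type_I R C `|` type_II R C N r c `|` type_III R C N r c
      `|` type_IV R C N r c))%classic.

Lemma in_diagonal_blocks i j : ((i, j) \in S) = (f i == g j).
Proof.
apply/bigcupP/eqP => [[k _]|fg].
  by rewrite inE /= rowP colP => /andP[/eqP-> /eqP->].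
by exists (f i) => //; rewrite inE /= rowP colP fg eqxx.
Qed.

Lemma same_partE i i' : same_part N r i i' = (f i == f i').
Proof.
apply/existsP/eqP => [[k]|ff]; first by rewrite !rowP => /andP[/eqP-> /eqP->].
by exists (f i); rewrite !rowP ff eqxx.
Qed.

Lemma same_part_colE j j' : same_part N c j j' = (g j == g j').
Proof.
apply/existsP/eqP => [[k]|gg]; first by rewrite !colP => /andP[/eqP-> /eqP->].
by exists (g j); rewrite !colP gg eqxx.
Qed.

Lemma same_blockE i j i' j' :
  same_block N r c (i, j) (i', j') = (f i == f i') && (g j == g j').
Proof.
apply/existsP/andP => [[k /existsP[l]]|[/eqP ff /eqP gg]].
  rewrite !inE /= !rowP !colP.
  by case/andP=> /andP[/eqP-> /eqP->] /andP[/eqP-> /eqP->].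
exists (f i); apply/existsP; exists (g j).
by rewrite !inE /= !rowP !colP ff gg !eqxx.
Qed.

Ltac move_ring := apply/statistic_eq0P; split=> [?|?|];
  rewrite !(totD, totN, totE) /= ?in_diagonal_blocks; try ring.

(** Row and column sums of a basic swap vanish by themselves; the numerical hypothesis is the
    remaining condition, that as many cells of [S] are added as removed. *)
Lemma basis_swap i i' j j' : (i != i') && (j != j') ->
    ((f i == g j) + (f i' == g j') = (f i == g j') + (f i' == g j))%N ->
  basis (E i j + E i' j' - E i j' - E i' j).
Proof.
case/andP=> ii' jj' bal; split; last by do 3!left; exists i, i', j, j'.
by rewrite /moves /=; move_ring; lia.
Qed.

(** The six cells fill the off-diagonal blocks of a 3 by 3 pattern with the same three indices for
    rows and columns, so they avoid [S] and lie in distinct blocks. *)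
Lemma basis_hexagon i1 i2 i3 j1 j2 j3 :
    uniq [:: f i1; f i2; f i3] -> f i1 = g j1 -> f i2 = g j2 -> f i3 = g j3 ->
  basis (E i1 j2 + E i2 j3 + E i3 j1 - E i1 j3 - E i2 j1 - E i3 j2).
Proof.
rewrite /= !inE !negb_or andbT => /andP[/andP[n12 n13] n23] e1 e2 e3.
have neq := (negPf n12, negPf n13, negPf n23).
have neqC := (eq_sym (f i2) (f i1), eq_sym (f i3) (f i1), eq_sym (f i3) (f i2)).
split; first by rewrite /moves /=; move_ring; rewrite -e1 -e2 -e3 !neqC !neq.
left; left; right; exists i1, i2, i3, j1, j2, j3; split=> //.
- rewrite /= !inE !negb_or andbT; apply/andP; split; [apply/andP; split|].
  + by apply: contraNneq n12 => ->.
  + by apply: contraNneq n13 => ->.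
  + by apply: contraNneq n23 => ->.
- rewrite /= !inE !negb_or andbT; apply/andP; split; [apply/andP; split|].
  + by apply: contraNneq n12; rewrite e1 e2 => ->.
  + by apply: contraNneq n13; rewrite e1 e3 => ->.
  + by apply: contraNneq n23; rewrite e2 e3 => ->.
- rewrite /in_distinct_blocks /= !finset.in_setC !in_diagonal_blocks.
  rewrite !same_blockE.
  by rewrite -e1 -e2 -e3 !neqC !neq !andbF.
Qed.

(** A loop at [k], in [(i2, j2)], is traded for a loop at [l], in [(i1, j1)]. The indices [f i3] and
    [g j3] may be equal, since [(i3, j3)] does not occur in the move. *)
Lemma basis_III k l i1 i2 i3 j1 j2 j3 : k != l ->
    f i1 = l -> g j1 = l -> f i2 = k -> g j2 = k ->
    (f i3 != k) && (f i3 != l) -> (g j3 != k) && (g j3 != l) ->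
  basis (E i1 j1 + E i2 j3 + E i3 j2 - E i1 j3 - E i2 j2 - E i3 j1).
Proof.
move=> kl fi1 gj1 fi2 gj2 /andP[ik il] /andP[jk jl].
have neq := (negPf kl, negPf ik, negPf il, negPf jk, negPf jl).
have neqC := (eq_sym l k, eq_sym k (f i3), eq_sym l (f i3),
              eq_sym k (g j3), eq_sym l (g j3)).
have eqs := (fi1, gj1, fi2, gj2).
split; first by rewrite /moves /=; move_ring; rewrite !eqs !neqC !neq !eqxx.
left; right; exists i1, i2, i3, j1, j2, j3; split=> //.
- rewrite /= !inE !negb_or andbT; apply/andP; split; [apply/andP; split|].
  + by apply: contraNneq kl => e; rewrite -fi1 -fi2 e.
  + by apply: contraNneq il => <-; rewrite fi1.
  + by apply: contraNneq ik => <-; rewrite fi2.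
- rewrite /= !inE !negb_or andbT; apply/andP; split; [apply/andP; split|].
  + by apply: contraNneq kl => e; rewrite -gj1 -gj2 e.
  + by apply: contraNneq jl => <-; rewrite gj1.
  + by apply: contraNneq jk => <-; rewrite gj2.
- rewrite /in_distinct_blocks /= !in_diagonal_blocks !same_blockE.
  by rewrite !eqs !neqC !neq !eqxx.
- rewrite /in_distinct_blocks /= !finset.in_setC !in_diagonal_blocks.
  rewrite !same_blockE.
  by rewrite !eqs !neqC !neq !andbF.
Qed.

(** On blocks, with [p = g j3] and [q = g j4], the cells [(k, k)], [(k, l)], [(l, p)], [(l, q)]
    become [(l, l)], [(l, k)], [(k, p)], [(k, q)]: a loop passes from [k] to [l] within the rows of
    these two blocks. *)
Lemma basis_IV_rows k l i1 i2 i3 i4 j1 j2 j3 j4 : k != l ->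
    f i1 = l -> f i2 = l -> g j1 = l -> f i3 = k -> f i4 = k -> g j2 = k ->
    (g j3 != k) && (g j3 != l) -> (g j4 != k) && (g j4 != l) ->
  basis (E i1 j1 + E i2 j2 + E i3 j3 + E i4 j4
         - E i1 j3 - E i2 j4 - E i3 j2 - E i4 j1).
Proof.
move=> kl fi1 fi2 gj1 fi3 fi4 gj2 /andP[k3 l3] /andP[k4 l4].
have neq := (negPf kl, negPf k3, negPf l3, negPf k4, negPf l4).
have neqC := (eq_sym l k, eq_sym k (g j3), eq_sym l (g j3),
              eq_sym k (g j4), eq_sym l (g j4)).
have eqs := (fi1, fi2, gj1, fi3, fi4, gj2).
split; first by rewrite /moves /=; move_ring; rewrite !eqs !neqC !neq !eqxx.
right; left; exists i1, i2, i3, i4, j1, j2, j3, j4; split=> //.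
- rewrite /in_distinct_blocks /= !in_diagonal_blocks !same_blockE.
  by rewrite !eqs !neqC !neq !eqxx.
- by rewrite /= !finset.in_setC !in_diagonal_blocks !eqs !neqC !neq.
- by rewrite same_partE !eqs.
- by rewrite same_partE !eqs.
Qed.

Lemma basis_IV_cols k l i1 i2 i3 i4 j1 j2 j3 j4 : k != l ->
    g j1 = l -> g j2 = l -> f i1 = l -> g j3 = k -> g j4 = k -> f i2 = k ->
    (f i3 != k) && (f i3 != l) -> (f i4 != k) && (f i4 != l) ->
  basis (E i1 j1 + E i2 j2 + E i3 j3 + E i4 j4
         - E i3 j1 - E i4 j2 - E i2 j3 - E i1 j4).
Proof.
move=> kl gj1 gj2 fi1 gj3 gj4 fi2 /andP[k3 l3] /andP[k4 l4].
have neq := (negPf kl, negPf k3, negPf l3, negPf k4, negPf l4).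
have neqC := (eq_sym l k, eq_sym k (f i3), eq_sym l (f i3),
              eq_sym k (f i4), eq_sym l (f i4)).
have eqs := (gj1, gj2, fi1, gj3, gj4, fi2).
split; first by rewrite /moves /=; move_ring; rewrite !eqs !neqC !neq !eqxx.
right; right; exists i1, i2, i3, i4, j1, j2, j3, j4; split=> //.
- rewrite /in_distinct_blocks /= !in_diagonal_blocks !same_blockE.
  by rewrite !eqs !neqC !neq !eqxx.
- by rewrite /= !finset.in_setC !in_diagonal_blocks !eqs !neqC !neq.
- by rewrite same_part_colE !eqs.
- by rewrite same_part_colE !eqs.
Qed.

Lemma sub_basis : (basis `<=` moves S)%classic.
Proof. by move=> z []. Qed.

Ltac conjuncts :=
  repeat match goal with H : is_true (_ && _) |- _ => case/andP: H => ? ? end;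
  repeat (apply/andP; split); assumption.

(** In each type, a relabelling of the indices exchanges positive and negative cells and keeps the
    side conditions, up to order and symmetry. *)
Lemma basisN z : basis z -> basis (- z).
Proof.
case=> Sz types; split.
  by rewrite /moves /= statisticN (_ : statistic S z = 0) ?oppr0.
case: types => [[[|]|]|[|]].
- case=> i1 [i2 [j1 [j2 [ii jj ->]]]]; do 3!left; exists i1, i2, j2, j1.
  by split; [|rewrite eq_sym|table_ring].
- case=> i1 [i2 [i3 [j1 [j2 [j3 [ui uj cells ->]]]]]].
  left; left; right; exists i1, i3, i2, j1, j3, j2; split; last by table_ring.
  + by move: ui; rewrite /= !inE [i3 == i2]eq_sym orbC.
  + by move: uj; rewrite /= !inE [j3 == j2]eq_sym orbC.
  move: cells; rewrite /in_distinct_blocks /= !same_blockE.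
  rewrite ![f i3 == f i1]eq_sym ![f i2 == f i1]eq_sym ![f i3 == f i2]eq_sym.
  rewrite ![g j3 == g j1]eq_sym ![g j2 == g j1]eq_sym ![g j3 == g j2]eq_sym.
  by move=> cells; conjuncts.
- case=> i1 [i2 [i3 [j1 [j2 [j3 [ui uj diag cells ->]]]]]].
  left; right; exists i2, i1, i3, j2, j1, j3; split; last by table_ring.
  + by move: ui; rewrite /= !inE [i2 == i1]eq_sym; lia.
  + by move: uj; rewrite /= !inE [j2 == j1]eq_sym; lia.
  + move: diag; rewrite /in_distinct_blocks /= !same_blockE.
    rewrite [f i2 == f i1]eq_sym [g j2 == g j1]eq_sym => ?; conjuncts.
  move: cells; rewrite /in_distinct_blocks /= !same_blockE.
  rewrite ![f i3 == f i1]eq_sym ![f i2 == f i1]eq_sym ![f i3 == f i2]eq_sym.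
  rewrite ![g j3 == g j1]eq_sym ![g j2 == g j1]eq_sym ![g j3 == g j2]eq_sym.
  by move=> cells; conjuncts.
- case=> i1 [i2 [i3 [i4 [j1 [j2 [j3 [j4 [diag cells p12 p34 ->]]]]]]]].
  right; left; exists i3, i4, i1, i2, j2, j1, j3, j4; split=> //;
    last by table_ring.
    move: diag; rewrite /in_distinct_blocks /= !same_blockE.
    rewrite [f i3 == _]eq_sym [g j2 == _]eq_sym => ?; conjuncts.
  by move: cells => /= ?; conjuncts.
- case=> i1 [i2 [i3 [i4 [j1 [j2 [j3 [j4 [diag cells p12 p34 ->]]]]]]]].
  right; right; exists i2, i1, i3, i4, j3, j4, j1, j2; split=> //;
    last by table_ring.
    move: diag; rewrite /in_distinct_blocks /= !same_blockE.
    rewrite [f i2 == _]eq_sym [g j3 == _]eq_sym => ?; conjuncts.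
  by move: cells => /= ?; conjuncts.
Qed.

(** * Single steps of the descent: one norm drops while the totals of another key vanish *)

Definition improvable (T T' : finType) (h : 'I_R * 'I_C -> T)
    (h' : 'I_R * 'I_C -> T') x y : Prop :=
  exists x' y', [/\ connected basis x x', connected basis y y',
    forall t, agg h (x' - y') t = 0 & norm h' (x' - y') < norm h' (x - y)].

Lemma aggBC (T : finType) (h : 'I_R * 'I_C -> T) x y t :
  agg h (y - x) t = - agg h (x - y) t.
Proof. by rewrite -aggN opprB. Qed.

Lemma improvableC (T T' : finType) (h : 'I_R * 'I_C -> T)
    (h' : 'I_R * 'I_C -> T') x y :
  improvable h h' y x -> improvable h h' x y.
Proof.
case=> y' [x' [yy' xx' hxy lt_norm]]; exists x', y'; split=> // [t|].
  by rewrite aggBC hxy oppr0.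
by rewrite -(normN _ (x' - y')) -(normN _ (x - y)) !opprB.
Qed.

(** Exchanging the two tables changes the sign of their difference, and by [improvableC] nothing
    else, so a class in excess can be assumed. *)
Lemma improvable_pos (T T' : finType) (h : 'I_R * 'I_C -> T)
    (h' : 'I_R * 'I_C -> T') :
    (forall x y t, nonneg x -> nonneg y -> statistic S (x - y) = 0 ->
      (forall t, agg h (x - y) t = 0) -> 0 < agg h' (x - y) t ->
      improvable h h' x y) ->
  forall x y, nonneg x -> nonneg y -> statistic S (x - y) = 0 ->
    (forall t, agg h (x - y) t = 0) -> norm h' (x - y) <> 0 ->
    improvable h h' x y.
Proof.
move=> pos x y x0 y0 sxy hxy /norm_neq0[t].
rewrite neq_lt => /orP[neg|/pos]; last exact.
apply: improvableC; apply: (pos _ _ t) => //; last by rewrite aggBC oppr_gt0.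
- by rewrite -opprB statisticN sxy oppr0.
- by move=> t'; rewrite aggBC hxy oppr0.
Qed.

(** The swap of [closer_swap] is applied to [y]. The last hypothesis makes it a move and keeps the
    totals under [h] unchanged. *)
Lemma swap_improves (A B T : finType) (u : 'I_R -> A) (v : 'I_C -> B)
    (h : 'I_R * 'I_C -> T) x y a a' b b' :
    nonneg x -> nonneg y -> (forall t, agg h (x - y) t = 0) ->
    0 < agg (prod_key u v) (x - y) (a, b) ->
    agg (prod_key u v) (x - y) (a, b') < 0 ->
    agg (prod_key u v) (x - y) (a', b) < 0 ->
    (forall i i' j j', u i = a -> u i' = a' -> v j = b -> v j' = b' ->
      ((f i == g j) + (f i' == g j') = (f i == g j') + (f i' == g j))%N /\
      forall t, agg h (E i j + E i' j' - E i j' - E i' j) t = 0) ->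
  improvable h (prod_key u v) x y.
Proof.
move=> x0 y0 hxy wab wab' wa'b bal.
have [i [i' [j [j' [ij [ui ui'] [vj vj'] [yz lt_norm]]]]]] :=
  closer_swap x0 y0 wab wab' wa'b.
have [Sbal hbal] := bal i i' j j' ui ui' vj vj'.
exists x; eexists; split; last exact: lt_norm.
- exact: connected_refl.
- by apply: connected1 => //; apply: basis_swap.
- by move=> t; rewrite opprD addrA aggD hxy aggN hbal subr0.
Qed.

(** * Vanishing totals, and connection of tables with equal block counts *)

Lemma row_total (Q : pred 'I_R) w : statistic S w = 0 ->
  tot (fun p => Q p.1) w = 0.
Proof.
case/statistic_eq0P=> rows _ _.
rewrite (tot_agg (fun p => p.1) Q) big1 // => i _; exact: rows.
Qed.

Lemma col_total (Q : pred 'I_C) w : statistic S w = 0 ->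
  tot (fun p => Q p.2) w = 0.
Proof.
case/statistic_eq0P=> _ cols _.
rewrite (tot_agg (fun p => p.2) Q) big1 // => j _; exact: cols.
Qed.

Lemma diag_total w : statistic S w = 0 -> tot (fun p => f p.1 == g p.2) w = 0.
Proof.
case/statistic_eq0P=> _ _ <-; apply: eq_tot => -[i j].
by rewrite /= in_diagonal_blocks.
Qed.

(** The stages come in reverse order, each one ending the descent of the next. Here the row sum
    gives one negative corner, and the equal counts by block of rows and column give the other in a
    row of the same block, so the swap preserves the sum over [S]. *)
Lemma connected_equal_rows x y : nonneg x -> nonneg y ->
    statistic S (x - y) = 0 -> (forall t, agg (prod_key f id) (x - y) t = 0) ->
  connected basis x y.
Proof.
pose Q w := forall t, agg (prod_key f id) w t = 0.
apply: (descent sub_basis basisN (h := prod_key id id) (Q := Q)); last first.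
  move=> {}x {}y x0 y0 _ xy0; suff -> : x = y by exact: connected_refl.
  apply/subr0_eq/matrixP => i j; rewrite [RHS]mxE.
  by rewrite -(xy0 (i, j)) /agg /tot (big_pred1 (i, j)) => [|[]].
apply: improvable_pos => {}x {}y [i j] x0 y0 sxy hxy wij.
have [||[_ j'] /= /eqP-> wij'] :=
  @agg_neg _ _ _ (prod_key id id) (fun t => t.1 == i) _ _ _ _ wij.
- exact: (row_total (pred1 i)).
- exact: eqxx.
have [||[i' _] /= /andP[/eqP fi' /eqP->] wi'j] :=
  @agg_neg _ _ _ (prod_key id id)
    (fun t => (f t.1 == f i) && (t.2 == j)) _ _ _ _ wij.
- by rewrite -(hxy (f i, j)); apply: eq_tot => p; rewrite xpair_eqE.
- by rewrite /= !eqxx.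
apply: (swap_improves x0 y0 hxy wij wij' wi'j) => i0 i1 j0 j1 /= -> -> _ _.
split=> [|t]; first by rewrite fi' addnC.
by rewrite !(aggD, aggN, aggE) /prod_key /= fi'; ring.
Qed.

(** Equal block counts give a negative corner in another column of the same block, and the column
    sum gives the other corner; the swap exchanges columns of one block. *)
Lemma connected_equal_blocks x y : nonneg x -> nonneg y ->
    statistic S (x - y) = 0 -> (forall t, agg (prod_key f g) (x - y) t = 0) ->
  connected basis x y.
Proof.
pose Q w := forall t, agg (prod_key f g) w t = 0.
apply: (descent sub_basis basisN (h := prod_key f id) (Q := Q)); last first.
  exact: connected_equal_rows.
apply: improvable_pos => {}x {}y [k j] x0 y0 sxy hxy wkj.
have [||[_ j'] /= /andP[/eqP-> /eqP gj'] wkj'] :=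
  @agg_neg _ _ _ (prod_key f id)
    (fun t => (t.1 == k) && (g t.2 == g j)) _ _ _ _ wkj.
- by rewrite -(hxy (k, g j)); apply: eq_tot => p; rewrite xpair_eqE.
- by rewrite /= !eqxx.
have [||[k' _] /= /eqP-> wk'j] :=
  @agg_neg _ _ _ (prod_key f id) (fun t => t.2 == j) _ _ _ _ wkj.
- exact: (col_total (pred1 j)).
- exact: eqxx.
apply: (swap_improves x0 y0 hxy wkj wkj' wk'j) => i0 i1 j0 j1 _ _ /= -> ->.
split=> [|t]; first by rewrite gj'.
by rewrite !(aggD, aggN, aggE) /prod_key /= gj'; ring.
Qed.

(** * Loop counts, and connection of tables with equal loop counts *)

Definition loop_key (p : 'I_R * 'I_C) : option 'I_N :=
  if f p.1 == g p.2 then Some (f p.1) else None.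

Lemma agg_loop x k : agg loop_key x (Some k) = agg (prod_key f g) x (k, k).
Proof.
apply: eq_tot => -[i j]; rewrite /loop_key /prod_key /= xpair_eqE.
have [<-|fg] := eqVneq (f i) (g j); first by rewrite andbb.
by apply/esym/negP => /andP[/eqP fk /eqP gk]; rewrite fk gk eqxx in fg.
Qed.

(* The explicit pair type keeps all instances syntactically equal for lia. *)
Local Notation Z w k l := (agg (prod_key f g) w (@pair 'I_N 'I_N k l)).

Lemma row_neg k l w : statistic S w = 0 -> 0 < Z w k l ->
  exists l', Z w k l' < 0.
Proof.
move=> sw wkl.
have [||[k' l'] /= /eqP-> wkl'] :=
  @agg_neg _ _ _ (prod_key f g) (fun t => t.1 == k) _ _ _ _ wkl.
- exact: (row_total (fun i => f i == k)).
- exact: eqxx.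
by exists l'.
Qed.

Lemma col_neg k l w : statistic S w = 0 -> 0 < Z w k l ->
  exists k', Z w k' l < 0.
Proof.
move=> sw wkl.
have [||[k' l'] /= /eqP-> wkl'] :=
  @agg_neg _ _ _ (prod_key f g) (fun t => t.2 == l) _ _ _ _ wkl.
- exact: (col_total (fun j => g j == l)).
- exact: eqxx.
by exists k'.
Qed.

Lemma row_pos k l w : statistic S w = 0 -> Z w k l < 0 ->
  exists l', 0 < Z w k l'.
Proof.
move=> sw wkl; have [||l'] := @row_neg k l (- w).
- by rewrite statisticN sw oppr0.
- by rewrite aggN oppr_gt0.
by rewrite aggN oppr_lt0; exists l'.
Qed.

Lemma col_pos k l w : statistic S w = 0 -> Z w k l < 0 ->
  exists k', 0 < Z w k' l.
Proof.
move=> sw wkl; have [||l'] := @col_neg k l (- w).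
- by rewrite statisticN sw oppr0.
- by rewrite aggN oppr_gt0.
by rewrite aggN oppr_lt0; exists l'.
Qed.

(** The three nonzero corners are off the diagonal because the loop counts agree, the fourth because
    [k' != l']; the swap therefore avoids [S]. *)
Lemma offdiag_swap_improves x y k k' l l' : nonneg x -> nonneg y ->
    (forall t, agg loop_key (x - y) t = 0) -> k' != l' ->
    0 < Z (x - y) k l -> Z (x - y) k l' < 0 -> Z (x - y) k' l < 0 ->
  improvable loop_key (prod_key f g) x y.
Proof.
move=> x0 y0 hxy /negPf k'l' wkl wkl' wk'l.
have offdiag a b : Z (x - y) a b != 0 -> (a == b) = false.
  by move=> wab; apply: contraNF wab => /eqP->; rewrite -agg_loop hxy.
have /offdiag kl := lt0r_neq0 wkl.
have /offdiag kl' := ltr0_neq0 wkl'.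
have /offdiag k'l := ltr0_neq0 wk'l.
apply: (swap_improves x0 y0 hxy wkl wkl' wk'l) => i i' j j' fi fi' gj gj'.
split=> [|t]; first by rewrite fi fi' gj gj' kl kl' k'l k'l'.
by rewrite !(aggD, aggN, aggE) /loop_key /= fi fi' gj gj' kl kl' k'l k'l'; ring.
Qed.

(** The move takes from [x] one cell in each of the three blocks in excess and adds one in each of
    the three in deficit, so six absolute values drop by 1. *)
Lemma hexagon_improves x y k l m : nonneg x -> nonneg y ->
    uniq [:: k; l; m] ->
    (forall t, agg loop_key (x - y) t = 0) ->
    0 < Z (x - y) k l -> 0 < Z (x - y) l m -> 0 < Z (x - y) m k ->
    Z (x - y) k m < 0 -> Z (x - y) m l < 0 -> Z (x - y) l k < 0 ->
  improvable loop_key (prod_key f g) x y.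
Proof.
move=> x0 y0 uniq_klm hxy wkl wlm wmk wkm wml wlk.
move: (uniq_klm); rewrite /= !inE !negb_or andbT => /andP[/andP[kl km] lm].
have neq := (negPf kl, negPf km, negPf lm).
have neqC := (eq_sym l k, eq_sym m k, eq_sym m l).
have keyE i j : prod_key f g (i, j) = (f i, g j) by [].
have xge t : 0 < agg (prod_key f g) (x - y) t -> 0 < agg (prod_key f g) x t.
  rewrite aggD aggN.
  have := tot_ge0 (fun p => prod_key f g p == t) y0.
  by rewrite -/(agg _ y t); lia.
have [ik [jl [/eqP[fik gjl] x1]]] := pick_cell x0 (xge _ wkl).
have xlm : 0 < Z (x - E ik jl) l m.
  rewrite aggD aggN aggE keyE fik gjl xpair_eqE !neq subr0; exact: xge.
have [il [jm [/eqP[fil gjm] x2]]] := pick_cell x1 xlm.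
have xmk : 0 < Z (x - E ik jl - E il jm) m k.
  rewrite !(aggD, aggN, aggE) !keyE fik gjl fil gjm.
  rewrite !xpair_eqE !neqC !neq /= !subr0.
  exact: xge.
have [im [jk [/eqP[fim gjk] x3]]] := pick_cell x2 xmk.
pose z := E ik jm + E im jl + E il jk - E ik jl - E im jk - E il jm.
have Bz : basis z.
  by apply: basis_hexagon; rewrite ?fik ?fil ?fim //= !inE !neqC !neq.
exists (x + z), y; split; last first.
- have -> : x + z - y = x - y - E ik jl - E il jm - E im jk
                        + E ik jm + E im jl + E il jk by rewrite /z; table_ring.
  move: (x - y) wkl wlm wmk wkm wml wlk => w wkl wlm wmk wkm wml wlk.
  rewrite !normD1 !normB1 !(aggD, aggN, aggE) !keyE fik gjl fil gjm fim gjk.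
  rewrite !xpair_eqE !neqC !neq !eqxx /=; lia.
- move=> t; rewrite addrAC aggD hxy /z !(aggD, aggN, aggE) /loop_key /=.
  by rewrite fik gjl fil gjm fim gjk !neqC !neq; ring.
- exact: connected_refl.
apply: connected1 => //.
have -> : x + z = x - E ik jl - E il jm - E im jk + E ik jm + E im jl + E il jk.
  by rewrite /z; table_ring.
by do 3!apply: nonneg_addE.
Qed.

Lemma connected_equal_loops x y : nonneg x -> nonneg y ->
    statistic S (x - y) = 0 -> (forall t, agg loop_key (x - y) t = 0) ->
  connected basis x y.
Proof.
pose Q w := forall t, agg loop_key w t = 0.
apply: (descent sub_basis basisN (h := prod_key f g) (Q := Q)); last first.
  exact: connected_equal_blocks.
apply: improvable_pos => {}x {}y [k l] x0 y0 sxy hxy wkl.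
have syx : statistic S (y - x) = 0 by rewrite -opprB statisticN sxy oppr0.
have hyx t : agg loop_key (y - x) t = 0 by rewrite aggBC hxy oppr0.
have posC a b : 0 < Z (y - x) a b = (Z (x - y) a b < 0).
  by rewrite aggBC oppr_gt0.
have negC a b : Z (y - x) a b < 0 = (0 < Z (x - y) a b).
  by rewrite aggBC oppr_lt0.
have offdiag a b : Z (x - y) a b != 0 -> a != b.
  by move=> wab; apply: contraNneq wab => ->; rewrite -agg_loop hxy.
(* Zero row and column totals supply entries of opposite sign. Each time, either the fourth corner
   of a rectangle is off the diagonal and a swap applies, or that corner is a loop and the new index
   is forced to be [k], [l] or [m]. *)
have [m wkm] := row_neg sxy wkl; have [m' wm'l] := col_neg sxy wkl.
have [e|m'm] := eqVneq m' m; last first.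
  exact: (offdiag_swap_improves x0 y0 hxy m'm wkl wkm wm'l).
rewrite {m'}e in wm'l.
have [n wnm] := col_pos sxy wkm; have [e|nl] := eqVneq n l; last first.
  apply/improvableC/(offdiag_swap_improves y0 x0 hyx nl (k := k) (l := m)).
  - by rewrite posC.
  - by rewrite negC.
  - by rewrite negC.
rewrite {n}e in wnm.
have [n wmn] := row_pos sxy wm'l; have [e|nk] := eqVneq n k; last first.
  apply/improvableC/(@offdiag_swap_improves y x m k l n y0 x0 hyx).
  - by rewrite eq_sym.
  - by rewrite posC.
  - by rewrite negC.
  - by rewrite negC.
rewrite {n}e in wmn.
have [n wln] := row_neg sxy wnm; have [e|nk] := eqVneq n k; last first.
  apply: (@offdiag_swap_improves x y l k m n x0 y0 hxy) => //.
  by rewrite eq_sym.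
rewrite {n}e in wln.
apply: (hexagon_improves x0 y0 _ hxy wkl wnm wmn wkm wm'l wln).
have := (offdiag _ _ (lt0r_neq0 wkl), offdiag _ _ (lt0r_neq0 wnm),
         offdiag _ _ (ltr0_neq0 wkm)).
by case=> -[kl lm] km; rewrite /= !inE !negb_or kl km lm.
Qed.

(** * Moving a loop from one index to another *)

Lemma norm_shift (T : finType) (h : 'I_R * 'I_C -> T) w z a b :
    (forall t, agg h z t = (b == t)%:Z - (a == t)%:Z) ->
    0 < agg h w a -> agg h w b < 0 ->
  norm h (w + z) < norm h w.
Proof.
move=> hz wa wb.
(* Only the drop at [a] is counted; at [b], a negative integer raised by 1 does not grow in absolute
   value. *)
suff : norm h (w + z) <= \sum_t (`|agg h w t| - (a == t)%:Z).
  rewrite sumrB -/(norm h w) (bigD1 a) //= eqxx big1 => [|t /negPf].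
    by lia.
  by rewrite eq_sym => ->.
apply: ler_sum => t _; rewrite aggD hz.
have ba : (b == a) = false by apply: contraTF wb => /eqP->; rewrite -leNgt ltW.
have [<-|_] := eqVneq a t; first by rewrite ba; lia.
by have [<-|_] := eqVneq b t; lia.
Qed.

Definition row_outside k l l' x : int :=
  tot (fun p => (f p.1 == k) && ((g p.2 != l) && (g p.2 != l'))) x.

Definition col_outside l k k' x : int :=
  tot (fun p => (g p.2 == l) && ((f p.1 != k) && (f p.1 != k'))) x.

Lemma row_split k l l' x : l != l' ->
  tot (fun p => f p.1 == k) x = Z x k l + Z x k l' + row_outside k l l' x.
Proof.
move=> ll'; rewrite (tot_split _ (fun p => g p.2 == l)).
rewrite [X in _ + X](tot_split _ (fun p => g p.2 == l')) -addrA.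
congr (_ + (_ + _)); apply: eq_tot => p /=; rewrite ?xpair_eqE ?andbA //.
case: (f p.1 == k) => //=.
have [->|] := eqVneq (g p.2) l'; last by rewrite andbF.
by rewrite eq_sym ll'.
Qed.

Lemma col_split l k k' x : k != k' ->
  tot (fun p => g p.2 == l) x = Z x k l + Z x k' l + col_outside l k k' x.
Proof.
move=> kk'; rewrite (tot_split _ (fun p => f p.1 == k)).
rewrite [X in _ + X](tot_split _ (fun p => f p.1 == k')) -addrA.
congr (_ + (_ + _)); apply: eq_tot => p /=; rewrite ?xpair_eqE ?andbA //.
  exact: andbC.
case: (g p.2 == l); rewrite /= ?andbF // andbT.
by have [->|] := eqVneq (f p.1) k'; rewrite ?andbF // eq_sym kk'.
Qed.

Lemma row_outsideC k l l' x : row_outside k l l' x = row_outside k l' l x.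
Proof. by apply: eq_tot => p; rewrite [X in _ && X]andbC. Qed.

Lemma col_outsideC l k k' x : col_outside l k k' x = col_outside l k' k x.
Proof. by apply: eq_tot => p; rewrite [X in _ && X]andbC. Qed.

(** The effect on the blocks outside [S] is left free: block counts are equalized only once the loop
    counts agree. *)
Definition loop_shift k l x : Prop :=
  exists2 z, basis z & nonneg (x + z) /\
    forall t, agg loop_key z t = (Some l == t)%:Z - (Some k == t)%:Z.

Lemma shift_III k l x : nonneg x -> k != l -> 0 < Z x k k ->
  0 < row_outside l k l x -> 0 < col_outside l k l x -> loop_shift k l x.
Proof.
move=> x0 kl xkk xl_ x_l.
have [i2 [j2 [/eqP[fi2 gj2] x1]]] := pick_cell x0 xkk.
have {}xl_ : 0 < row_outside l k l (x - E i2 j2).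
  by rewrite /row_outside totD totN totE /= fi2 (negPf kl) subr0.
have [i1 [j3 [/= /andP[/eqP fi1 gj3] x2]]] := pick_cell x1 xl_.
have {}x_l : 0 < col_outside l k l (x - E i2 j2 - E i1 j3).
  rewrite /col_outside !(totD, totN, totE) /= gj2 (negPf kl) subr0.
  by case/andP: gj3 => _ /negPf->; rewrite subr0.
have [i3 [j1 [/= /andP[/eqP gj1 fi3] x3]]] := pick_cell x2 x_l.
exists (E i1 j1 + E i2 j3 + E i3 j2 - E i1 j3 - E i2 j2 - E i3 j1).
  exact: (basis_III (k := k) (l := l)).
split=> [|t].
  have -> : x + (E i1 j1 + E i2 j3 + E i3 j2 - E i1 j3 - E i2 j2 - E i3 j1) =
    x - E i2 j2 - E i1 j3 - E i3 j1 + E i1 j1 + E i2 j3 + E i3 j2 by table_ring.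
  by do 3!apply: nonneg_addE.
case/andP: gj3 => jk jl; case/andP: fi3 => ik il.
rewrite !(aggD, aggN, aggE) /loop_key /= fi1 gj1 fi2 gj2 !eqxx.
rewrite ![_ == g j3]eq_sym (negPf jk) (negPf jl) (negPf ik) (negPf il); ring.
Qed.

Lemma shift_IV_rows k l x : nonneg x -> k != l -> 0 < Z x k k ->
  0 < Z x k l -> 1 < row_outside l k l x -> loop_shift k l x.
Proof.
move=> x0 kl xkk xkl xl_; have lk : l != k by rewrite eq_sym.
have [i3 [j2 [/eqP[fi3 gj2] x1]]] := pick_cell x0 xkk.
have {}xkl : 0 < Z (x - E i3 j2) k l.
  rewrite !(aggD, aggN, aggE) /prod_key /= fi3 gj2.
  by rewrite xpair_eqE (negPf kl) andbF subr0.
have [i4 [j1 [/eqP[fi4 gj1] x2]]] := pick_cell x1 xkl.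
have {}xl_ : 1 < row_outside l k l (x - E i3 j2 - E i4 j1).
  by rewrite /row_outside !(totD, totN, totE) /= fi3 fi4 (negPf kl) !subr0.
have [i1 [j3 [/= /andP[/eqP fi1 gj3] x3]]] := pick_cell x2 (lt_trans ltr01 xl_).
(* One of the two outside cells has been taken. The second may be the same cell again, which gives a
   move that is not square-free. *)
have {}xl_ : 0 < row_outside l k l (x - E i3 j2 - E i4 j1 - E i1 j3).
  rewrite /row_outside totD totN totE -/(row_outside l k l _).
  by move: xl_; case: (_ && _); lia.
have [i2 [j4 [/= /andP[/eqP fi2 gj4] x4]]] := pick_cell x3 xl_.
exists (E i1 j1 + E i2 j2 + E i3 j3 + E i4 j4
        - E i1 j3 - E i2 j4 - E i3 j2 - E i4 j1).
  exact: (basis_IV_rows (k := k) (l := l)).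
split=> [|t].
  have -> : x + (E i1 j1 + E i2 j2 + E i3 j3 + E i4 j4
                 - E i1 j3 - E i2 j4 - E i3 j2 - E i4 j1) =
    x - E i3 j2 - E i4 j1 - E i1 j3 - E i2 j4
      + E i1 j1 + E i2 j2 + E i3 j3 + E i4 j4 by table_ring.
  by do 4!apply: nonneg_addE.
case/andP: gj3 => k3 l3; case/andP: gj4 => k4 l4.
rewrite !(aggD, aggN, aggE) /loop_key /= fi1 fi2 fi3 fi4 gj1 gj2 !eqxx.
rewrite ![_ == g j3]eq_sym ![_ == g j4]eq_sym.
rewrite (negPf k3) (negPf l3) (negPf k4) (negPf l4) (negPf kl) (negPf lk); ring.
Qed.

Lemma shift_IV_cols k l x : nonneg x -> k != l -> 0 < Z x k k ->
  0 < Z x l k -> 1 < col_outside l k l x -> loop_shift k l x.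
Proof.
move=> x0 kl xkk xlk x_l; have lk : l != k by rewrite eq_sym.
have [i2 [j3 [/eqP[fi2 gj3] x1]]] := pick_cell x0 xkk.
have {}xlk : 0 < Z (x - E i2 j3) l k.
  rewrite !(aggD, aggN, aggE) /prod_key /= fi2 gj3.
  by rewrite xpair_eqE (negPf kl) subr0.
have [i1 [j4 [/eqP[fi1 gj4] x2]]] := pick_cell x1 xlk.
have {}x_l : 1 < col_outside l k l (x - E i2 j3 - E i1 j4).
  by rewrite /col_outside !(totD, totN, totE) /= gj3 gj4 (negPf kl) !subr0.
have [i3 [j1 [/= /andP[/eqP gj1 fi3] x3]]] := pick_cell x2 (lt_trans ltr01 x_l).
have {}x_l : 0 < col_outside l k l (x - E i2 j3 - E i1 j4 - E i3 j1).
  rewrite /col_outside totD totN totE -/(col_outside l k l _).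
  by move: x_l; case: (_ && _); lia.
have [i4 [j2 [/= /andP[/eqP gj2 fi4] x4]]] := pick_cell x3 x_l.
exists (E i1 j1 + E i2 j2 + E i3 j3 + E i4 j4
        - E i3 j1 - E i4 j2 - E i2 j3 - E i1 j4).
  exact: (basis_IV_cols (k := k) (l := l)).
split=> [|t].
  have -> : x + (E i1 j1 + E i2 j2 + E i3 j3 + E i4 j4
                 - E i3 j1 - E i4 j2 - E i2 j3 - E i1 j4) =
    x - E i2 j3 - E i1 j4 - E i3 j1 - E i4 j2
      + E i1 j1 + E i2 j2 + E i3 j3 + E i4 j4 by table_ring.
  by do 4!apply: nonneg_addE.
case/andP: fi3 => k3 l3; case/andP: fi4 => k4 l4.
rewrite !(aggD, aggN, aggE) /loop_key /= fi1 fi2 gj1 gj2 gj3 gj4 !eqxx.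
rewrite (negPf k3) (negPf l3) (negPf k4) (negPf l4) (negPf kl) (negPf lk); ring.
Qed.

Lemma loop_shift_exists k l x y : nonneg x -> nonneg y ->
    statistic S (x - y) = 0 -> Z y k k < Z x k k -> Z x l l < Z y l l ->
  loop_shift k l x \/ loop_shift l k y.
Proof.
move=> x0 y0 sxy xyk xyl.
have kl : k != l by apply: contraTneq xyl => <-; rewrite -leNgt ltW.
have lk : l != k by rewrite eq_sym.
have rows e : tot (fun p => f p.1 == e) x = tot (fun p => f p.1 == e) y.
  by apply/subr0_eq; rewrite -totN -totD (row_total (fun i => f i == e)).
have cols e : tot (fun p => g p.2 == e) x = tot (fun p => g p.2 == e) y.
  by apply/subr0_eq; rewrite -totN -totD (col_total (fun j => g j == e)).
have pos a b : 0 <= Z x a b /\ 0 <= Z y a b by split; apply: tot_ge0.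
have rpos a : 0 <= row_outside a k l x /\ 0 <= row_outside a k l y.
  by split; apply: tot_ge0.
have cpos a : 0 <= col_outside a k l x /\ 0 <= col_outside a k l y.
  by split; apply: tot_ge0.
have := (rows k, rows l, cols k, cols l).
rewrite !(row_split _ _ kl) !(col_split _ _ kl) => -[[[rk rl] ck] cl].
have [[[pkk pkl] plk] pll] := (pos k k, pos k l, pos l k, pos l l).
have [[[rpk rpl] cpk] cpl] := (rpos k, rpos l, cpos k, cpos l).
have [xr|xr] := ltP 0 (row_outside l k l x);
  have [xc|xc] := ltP 0 (col_outside l k l x).
- by left; apply: shift_III => //; lia.
(* With no outside cell in columns [l] of [x], their total gives [Z y k l < Z x k l], and that of
   rows [k] then makes [row_outside k k l y] positive. If [col_outside k k l y] is 0, the totals of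
   columns [k] and rows [l] give [1 < row_outside l k l x]. *)
- have [yc|yc] := ltP 0 (col_outside k k l y).
    have [yr|yr] := ltP 0 (row_outside k k l y).
      right; apply: shift_III; rewrite // 1?row_outsideC 1?col_outsideC //; lia.
    lia.
  by left; apply: shift_IV_rows => //; lia.
(* This is the transpose of the previous case. *)
- have [yr|yr] := ltP 0 (row_outside k k l y).
    have [yc|yc] := ltP 0 (col_outside k k l y).
      right; apply: shift_III; rewrite // 1?row_outsideC 1?col_outsideC //; lia.
    lia.
  by left; apply: shift_IV_cols => //; lia.
(* Now [y] has fewer cells than [x] in both blocks [(k, l)] and [(l, k)], hence outside cells in
   rows and columns [k]: Type III applies to [y], and the last two branches are contradictory. *)
- have [yr|yr] := ltP 0 (row_outside k k l y).
    have [yc|yc] := ltP 0 (col_outside k k l y).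
      right; apply: shift_III; rewrite // 1?row_outsideC 1?col_outsideC //; lia.
    by left; apply: shift_IV_rows => //; lia.
  by left; apply: shift_IV_cols => //; lia.
Qed.

Lemma connected_fiber x y : nonneg x -> nonneg y ->
  statistic S (x - y) = 0 -> connected basis x y.
Proof.
(* Nothing is equalized before the first stage: with a constant key, [Q] only states that the grand
   total vanishes. *)
move=> x0 y0 sxy; pose Q w := forall t, agg (fun=> tt) w t = 0.
have Q0 w : statistic S w = 0 -> Q w.
  by move=> sw t; apply: (row_total xpredT).
move: x0 y0 sxy (Q0 _ sxy).
apply: (descent sub_basis basisN (h := loop_key));
  last exact: connected_equal_loops.
apply: improvable_pos => {}x {}y t x0 y0 sxy hxy.
have some_total : tot (fun p => isSome (loop_key p)) (x - y) = 0.
  rewrite -[RHS](diag_total sxy); apply: eq_tot => p.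
  by rewrite /loop_key; case: eqP.
(* All cells outside [S] share the key [None]. Its total vanishes with the grand total and the total
   over [S], so an excess is at a loop and is answered by a deficit at another loop. *)
have none_total : agg loop_key (x - y) None = 0.
  have := row_total xpredT sxy.
  rewrite (tot_split _ (fun p => isSome (loop_key p))).
  rewrite some_total add0r => <-; apply: eq_tot => p.
  by rewrite /loop_key; case: (f p.1 == g p.2).
case: t => [k|]; last by rewrite none_total.
move=> wk; have [//|[l|//] _ wl] :=
  @agg_neg _ _ _ loop_key isSome _ _ some_total _ wk.
have [||[z Bz [xz hz]]|[z Bz [yz hz]]] := @loop_shift_exists k l x y x0 y0 sxy.
- by rewrite -!agg_loop -subr_gt0 -aggN -aggD.
- by rewrite -!agg_loop -subr_lt0 -aggN -aggD.
- have le_norm := norm_shift hz wk wl.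
  exists (x + z), y; rewrite addrAC; split=> //; last first.
  + by apply: Q0; rewrite statisticD sxy add0r; case: Bz.
  + exact: connected_refl.
  exact: connected1.
- have le_norm : norm loop_key (y - x + z) < norm loop_key (y - x).
    by apply: (norm_shift hz); rewrite aggBC ?oppr_gt0 ?oppr_lt0.
  exists x, (y + z); split=> //.
  + exact: connected_refl.
  + exact: connected1.
  + apply: Q0; rewrite opprD addrA statisticD sxy add0r statisticN.
    by case: Bz => Sz _; rewrite (_ : statistic S z = 0) ?oppr0.
  by rewrite -normN opprB addrAC -(normN _ (x - y)) opprB.
Qed.

End BlockModel.

(** * Finiteness of the basis, and construction of the part index *)

Lemma finite_range2 (I J : finType) (T : Type) (F : I -> J -> T) (A : set T) :
  (forall z, A z -> exists i j, z = F i j) -> finite_set A.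
Proof.
move=> AF.
apply: (@sub_finite_set _ _ ((fun p : I * J => F p.1 p.2) @` setT)%classic).
  by move=> z /AF[i [j ->]]; exists (i, j).
by apply: finite_image; apply: finite_finset.
Qed.

(** The part of [i] is the predecessor of the least [n] with [i < r n], which is positive since
    [r 0 = 0] and at most [N] since [r N = R]. Monotonicity of the breakpoints makes it unique. *)
Lemma part_indexP N R (r : nat -> nat) : partition_points N R r ->
  exists f : 'I_R -> 'I_N,
    forall (i : 'I_R) (k : 'I_N), (r k <= i < r k.+1)%N = (f i == k).
Proof.
case=> r0 rN rS.
have mono m n : (m <= n <= N)%N -> (r m <= r n)%N.
  case/andP=> + nN; elim: n nN => [|n IH] nN; first by rewrite leqn0 => /eqP->.
  rewrite leq_eqVlt => /predU1P[->//|mn].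
  by apply: leq_trans (ltnW (rS n nN)); apply: IH => //; apply: ltnW.
have ex (i : 'I_R) : exists k : 'I_N, (r k <= i < r k.+1)%N.
  have [n nP n_min] : {n | (n <= N) && (i < r n) &
                           forall m, (i < r m)%N -> (n <= m)%N}%N.
    have exn : exists n, (i < r n)%N by exists N; rewrite rN.
    exists (ex_minn exn); case: ex_minnP => n ir n_min //.
    by rewrite ir n_min // rN.
  case/andP: nP; case: n n_min => [|n] n_min nN irn; first by rewrite r0 in irn.
  exists (Ordinal nN); rewrite /= irn andbT leqNgt.
  by apply/negP => /n_min; rewrite ltnn.
have [f fP] := fin_all_exists ex.
exists f => i k; apply/idP/eqP => [|<- //].
case/andP=> rk rk1; have /andP[fk fk1] := fP i; apply/ord_inj/eqP.
rewrite eqn_leq; apply/andP; split; rewrite leqNgt; apply/negP => lt_k.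
  by have := mono _ _ (introT andP (conj lt_k (ltnW (ltn_ord (f i))))); lia.
by have := mono _ _ (introT andP (conj lt_k (ltnW (ltn_ord k)))); lia.
Qed.

Theorem theorem3 (R C N : nat) (r c : nat -> nat)
  (hR : (1 <= R)%N) (hC : (1 <= C)%N) (hN : (3 <= N)%N)
  (hr : partition_points N R r) (hc : partition_points N C c) :
  markov_basis (diagonal_blocks R C N r c)
    (moves (diagonal_blocks R C N r c) `&`
     (type_I R C `|` type_II R C N r c `|` type_III R C N r c
      `|` type_IV R C N r c))%classic.
Proof.
have [f rowP] := part_indexP hr; have [g colP] := part_indexP hc.
split.
- apply: finite_setIr; rewrite !finite_setU; do !split.
  + apply: (@finite_range2 _ _ _ (fun (i : 'I_R * 'I_R) (j : 'I_C * 'I_C) =>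
      E i.1 j.1 + E i.2 j.2 - E i.1 j.2 - E i.2 j.1)) => z.
    by case=> i1 [i2 [j1 [j2 [_ _ ->]]]]; exists (i1, i2), (j1, j2).
  + apply: (@finite_range2 _ _ _
      (fun (i : 'I_R * 'I_R * 'I_R) (j : 'I_C * 'I_C * 'I_C) =>
      E i.1.1 j.1.2 + E i.1.2 j.2 + E i.2 j.1.1
      - E i.1.1 j.2 - E i.1.2 j.1.1 - E i.2 j.1.2)) => z.
    case=> i1 [i2 [i3 [j1 [j2 [j3 [_ _ _ ->]]]]]].
    by exists (i1, i2, i3), (j1, j2, j3).
  + apply: (@finite_range2 _ _ _
      (fun (i : 'I_R * 'I_R * 'I_R) (j : 'I_C * 'I_C * 'I_C) =>
      E i.1.1 j.1.1 + E i.1.2 j.2 + E i.2 j.1.2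
      - E i.1.1 j.2 - E i.1.2 j.1.2 - E i.2 j.1.1)) => z.
    case=> i1 [i2 [i3 [j1 [j2 [j3 [_ _ _ _ ->]]]]]].
    by exists (i1, i2, i3), (j1, j2, j3).
  + apply: (@finite_range2 _ _ _
      (fun (i : 'I_R * 'I_R * 'I_R * 'I_R) (j : 'I_C * 'I_C * 'I_C * 'I_C) =>
      E i.1.1.1 j.1.1.1 + E i.1.1.2 j.1.1.2 + E i.1.2 j.1.2 + E i.2 j.2
      - E i.1.1.1 j.1.2 - E i.1.1.2 j.2 - E i.1.2 j.1.1.2
      - E i.2 j.1.1.1)) => z.
    case=> i1 [i2 [i3 [i4 [j1 [j2 [j3 [j4 [_ _ _ _ ->]]]]]]]].
    by exists (i1, i2, i3, i4), (j1, j2, j3, j4).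
  + apply: (@finite_range2 _ _ _
      (fun (i : 'I_R * 'I_R * 'I_R * 'I_R) (j : 'I_C * 'I_C * 'I_C * 'I_C) =>
      E i.1.1.1 j.1.1.1 + E i.1.1.2 j.1.1.2 + E i.1.2 j.1.2 + E i.2 j.2
      - E i.1.2 j.1.1.1 - E i.2 j.1.1.2 - E i.1.1.2 j.1.2
      - E i.1.1.1 j.2)) => z.
    case=> i1 [i2 [i3 [i4 [j1 [j2 [j3 [j4 [_ _ _ _ ->]]]]]]]].
    by exists (i1, i2, i3, i4), (j1, j2, j3, j4).
- by move=> z [].
- exact: basisN rowP colP.
move=> t x y [x0 xt] [y0 yt] xy.
have sxy : statistic (diagonal_blocks R C N r c) (x - y) = 0.
  by rewrite statisticD statisticN xt yt subrr.
have [U [z [Bz yE zP]]] :=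
  connected_path (@sub_basis R C N r c) (connected_fiber rowP colP x0 y0 sxy).
exists U, z; split=> // [|u /zP[u0 ut]].
  (* An empty path would give [x = y]. *)
  rewrite lt0n; apply/eqP => U0; move: yE.
  by rewrite U0 big_ord0 addr0 => /esym.
by split=> //; rewrite ut.
Qed.
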